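(* Assume that $H$ satisfies (H1)–(H4) and (H$^\infty$) listed in the context, and let $\lambda\in\mathbb{R}$. (a) If there is a real symmetric $2N\times2N$ matrix $C$ such that $$\langle g^+(t,\xi,\lambda),JC\xi\rangle>0\quad\text{for all }t\in\mathbb{R}\text{ and all }\xi\in\mathbb{R}^{2N}\setminus\{0\},$$ then $\{x\in H^1:F^+(\lambda,x)=0\}=\{0\}$. (b) If $g^+(t,\xi,\lambda)=A_\lambda^+(t)\xi$ for all $(t,\xi)\in\mathbb{R}\times\mathbb{R}^{2N}$ (that is, $g^+(t,\cdot,\lambda)$ is linear), then $\{x\in H^1:F^+(\lambda,x)=0\}=\{0\}$. (c) If $g^+(t,\xi,\lambda)$ is independent of $t$ and $0$ is an isolated zero of $H^+(\cdot,\lambda)$, where $H^+(\cdot,\lambda):\mathbb{R}^{2N}\to\mathbb{R}$ is a function with $D_\xi H^+(\xi,\lambda)=g^+(t,\xi,\lambda)$ for all $(t,\xi)$, then $\{x\in H^1:F^+(\lambda,x)=0\}=\{0\}$. The same conclusions hold when $g^+$ is replaced by $g^-$ (with $F^+,A_\lambda^+,H^+$ replaced by $F^-,A_\lambda^-,H^-$).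
   Context: Let $N\ge 1$ be an integer and $J$ a real $2N\times 2N$ matrix with $J^T=J^{-1}=-J$. $\langle\cdot,\cdot\rangle$ is the Euclidean scalar product on $\mathbb{R}^{2N}$. Write $L^2=L^2(\mathbb{R},\mathbb{R}^{2N})$ and $H^1=H^1(\mathbb{R},\mathbb{R}^{2N})$ with their usual norms; elements of $H^1$ are identified with their continuous representatives. Bundle maps: $f:\mathbb{R}\times\mathbb{R}^M\to\mathbb{R}$, $(t,\xi)\mapsto f(t,\xi)$, is an equicontinuous $C^0_\xi$-bundle map if $f$ is continuous and the family $\{f(t,\cdot)\}_{t\in\mathbb{R}}$ is equicontinuous at every point $\xi\in\mathbb{R}^M$; it is an equicontinuous $C^k_\xi$-bundle map if all partial derivatives $\partial^\kappa f/\partial\xi^\kappa$, $|\kappa|\le k$, exist and are equicontinuous $C^0_\xi$-bundle maps. For vector- or matrix-valued functions this is required of each component. Hypotheses on $H:\mathbb{R}\times\mathbb{R}^{2N}\times\mathbb{R}\to\mathbb{R}$, $(t,\xi,\lambda)\mapsto H(t,\xi,\lambda)$: (H1) $H$ is continuous, $H(t,\cdot,\lambda)\in C^2(\mathbb{R}^{2N})$ and $D_\xi H(t,0,\lambda)=0$ for all $t,\lambda\in\mathbb{R}$. (H2) The partial derivatives $D_\xi H$, $D_\xi^2H$, $D_\lambda D_\xi H$, $D_\lambda D_\xi^2H$ and $D_\xi D_\lambda D_\xi H$ exist and are continuous on $\mathbb{R}\times\mathbb{R}^{2N}\times\mathbb{R}$. (H3) For each $\lambda\in\mathbb{R}$,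 $D_\xi H(\cdot,\cdot,\lambda):\mathbb{R}\times\mathbb{R}^{2N}\to\mathbb{R}^{2N}$ is an equicontinuous $C^1_\xi$-bundle map, and $D_\lambda D_\xi^2H$, viewed as a matrix-valued function on $\mathbb{R}\times(\mathbb{R}^{2N}\times\mathbb{R})$, is an equicontinuous $C^0_{(\xi,\lambda)}$-bundle map. (H4) $D_\xi^2H(\cdot,0,0)$ and $D_\lambda D_\xi^2H(\cdot,0,0)$ belong to $L^\infty(\mathbb{R})$. (H$^\infty$) For every $\lambda\in\mathbb{R}$ there exist two equicontinuous $C^1_\xi$-bundle maps $g^+(\cdot,\cdot,\lambda),g^-(\cdot,\cdot,\lambda):\mathbb{R}\times\mathbb{R}^{2N}\to\mathbb{R}^{2N}$ such that: (1) $g^\pm(t,0,\lambda)=0$ for all $t,\lambda\in\mathbb{R}$; (2) $\lim_{t\to\infty}\{D_\xi^2H(t,\xi,\lambda)-D_\xi g^+(t,\xi,\lambda)\}=\lim_{t\to-\infty}\{D_\xi^2H(t,\xi,\lambda)-D_\xi g^-(t,\xi,\lambda)\}=0$ uniformly for $\xi$ in bounded subsets of $\mathbb{R}^{2N}$; (3) there are $T^+,T^->0$ (possibly depending on $\lambda$) with $g^\pm(t+T^\pm,\xi,\lambda)=g^\pm(t,\xi,\lambda)$ for all $(t,\xi)$. Define $F^\pm:\mathbb{R}\times H^1\to L^2$ by $F^\pm(\lambda,x)(t)=Jx'(t)-g^\pm(t,x(t),\lambda)$ (well defined when $H$ satisfies (H1)–(H4) and (H$^\infty$)), and $A_\lambda^\pm(t)=D_\xi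 g^\pm(t,0,\lambda)$. That $0$ is an isolated zero of a function means that the function vanishes at $0$ and has no other zero in some neighbourhood of $0$. *)

(* Defs.v *)
From HB Require Import structures.
From mathcomp Require Import all_boot all_order all_algebra.
From mathcomp Require Import all_classical all_reals all_analysis.

Set Implicit Arguments.
Unset Strict Implicit.
Unset Printing Implicit Defensive.

Import Order.TTheory GRing.Theory Num.Theory.
Import numFieldNormedType.Exports.
Local Open Scope classical_set_scope.
Local Open Scope ring_scope.

Definition dotv (R : realType) (n : nat) (u v : 'cV[R]_n) : R :=
  \sum_i u i 0 * v i 0.

(** Derivatives with respect to [xi]. [pderiv j], [grad] and [jac] are total
    operators, meaningful only where the derivatives exist; every hypothesis
    below that mentions them also requires existence. *)

Definition pderiv (R : realType) (n : nat) (j : 'I_n) (f : 'cV[R]_n -> R)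
  : 'cV[R]_n -> R := fun xi => 'D_(delta_mx j 0) f xi.

Definition grad (R : realType) (n : nat) (f : 'cV[R]_n -> R)
  : 'cV[R]_n -> 'cV[R]_n := fun xi => \col_j pderiv j f xi.

Definition jac (R : realType) (m n : nat) (f : 'cV[R]_n -> 'cV[R]_m)
  : 'cV[R]_n -> 'M[R]_(m, n) :=
  fun xi => \matrix_(i, j) pderiv j (fun eta => f eta i 0) xi.

Definition C2 (R : realType) (n : nat) (f : 'cV[R]_n -> R) : Prop :=
  [/\ forall xi, differentiable f xi,
      forall xi, differentiable (grad f) xi
    & continuous (jac (grad f))].

(** Equicontinuous bundle maps. The parameter space [X] is either R^M or
    R^M x R. *)

Definition C0_bundle (R : realType) (X : topologicalType) (f : R -> X -> R)
  : Prop :=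
  continuous (fun p : R * X => f p.1 p.2) /\ equicontinuous [set: R] f.

(* The derivatives of order <= k are taken as all iterated partial derivatives;
   since they are required to be continuous, they do not depend on the order of
   differentiation. *)
Fixpoint Ck_bundle (R : realType) (M k : nat) (f : R -> 'cV[R]_M -> R)
  : Prop :=
  C0_bundle f /\
  match k with
  | 0%N => True
  | k'.+1 => forall j : 'I_M,
      (forall t xi, derivable (f t) xi (delta_mx j 0)) /\
      Ck_bundle k' (fun t => pderiv j (f t))
  end.

Definition Ck_bundle_vec (R : realType) (M m k : nat)
    (f : R -> 'cV[R]_M -> 'cV[R]_m) : Prop :=
  forall i : 'I_m, Ck_bundle k (fun t xi => f t xi i 0).

Definition C0_bundle_mx (R : realType) (X : topologicalType) (m n : nat)
    (f : R -> X -> 'M[R]_(m, n)) : Prop :=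
  forall i j, C0_bundle (fun t x => f t x i j).

(** Derivatives of [H : R x R^n x R -> R], [(t, xi, lam) |-> H t xi lam]. *)

Section HamiltonianDerivatives.
Variables (R : realType) (n : nat) (H : R -> 'cV[R]_n -> R -> R).

Definition DxiH (t : R) (xi : 'cV[R]_n) (lam : R) : 'cV[R]_n :=
  grad (fun eta => H t eta lam) xi.

Definition Dxi2H (t : R) (xi : 'cV[R]_n) (lam : R) : 'M[R]_n :=
  jac (fun eta => DxiH t eta lam) xi.

Definition DlamDxiH (t : R) (xi : 'cV[R]_n) (lam : R) : 'cV[R]_n :=
  derive1 (fun l => DxiH t xi l) lam.

Definition DlamDxi2H (t : R) (xi : 'cV[R]_n) (lam : R) : 'M[R]_n :=
  derive1 (fun l => Dxi2H t xi l) lam.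

Definition DxiDlamDxiH (t : R) (xi : 'cV[R]_n) (lam : R) : 'M[R]_n :=
  jac (fun eta => DlamDxiH t eta lam) xi.

End HamiltonianDerivatives.

Definition continuous3 (R : realType) (n : nat) (V : topologicalType)
    (f : R -> 'cV[R]_n -> R -> V) : Prop :=
  continuous (fun p : R * 'cV[R]_n * R => f p.1.1 p.1.2 p.2).

Section Hypotheses.
Variables (R : realType) (n : nat) (H : R -> 'cV[R]_n -> R -> R).

Definition hypH1 : Prop :=
  [/\ continuous3 H,
      forall t lam, C2 (fun xi => H t xi lam)
    & forall t lam, DxiH H t 0 lam = 0].

Definition hypH2 : Prop :=
  [/\ (forall t xi lam, differentiable (fun eta => H t eta lam) xi) /\
        continuous3 (DxiH H),
      (forall t xi lam, differentiable (fun eta => DxiH H t eta lam) xi) /\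
        continuous3 (Dxi2H H),
      (forall t xi lam, derivable (fun l => DxiH H t xi l) lam 1) /\
        continuous3 (DlamDxiH H),
      (forall t xi lam, derivable (fun l => Dxi2H H t xi l) lam 1) /\
        continuous3 (DlamDxi2H H)
    & (forall t xi lam, differentiable (fun eta => DlamDxiH H t eta lam) xi) /\
        continuous3 (DxiDlamDxiH H)].

Definition hypH3 : Prop :=
  (forall lam, Ck_bundle_vec 1 (fun t xi => DxiH H t xi lam)) /\
  C0_bundle_mx (fun (t : R) (p : 'cV[R]_n * R) => DlamDxi2H H t p.1 p.2).

Definition hypH4 : Prop :=
  forall i j,
    (fun t => Dxi2H H t 0 0 i j) \in Lfun (@lebesgue_measure R) +oo%E /\
    (fun t => DlamDxi2H H t 0 0 i j) \in Lfun (@lebesgue_measure R) +oo%E.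

(* One half of the asymptotic hypothesis: [F] is the filter of neighbourhoods
   of +oo (for g^+) or of -oo (for g^-). *)
Definition asymptotically_periodic (F : set_system R)
    (g : R -> 'cV[R]_n -> R -> 'cV[R]_n) : Prop :=
  forall lam,
    [/\ Ck_bundle_vec 1 (fun t xi => g t xi lam),
        forall t, g t 0 lam = 0,
        forall B : set 'cV[R]_n, bounded_set B ->
          {uniform B,
            (fun t xi => Dxi2H H t xi lam - jac (fun eta => g t eta lam) xi)
              @ F --> (fun=> 0 : 'M[R]_n)}
      & exists2 T : R, 0 < T & forall t xi, g (t + T) xi lam = g t xi lam].

Definition hypHinf (gp gm : R -> 'cV[R]_n -> R -> 'cV[R]_n) : Prop :=
  asymptotically_periodic (pinfty_nbhs R) gp /\
  asymptotically_periodic (ninfty_nbhs R) gm.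

End Hypotheses.

(** The spaces L^2(R, R^n) and H^1(R, R^n), and the maps F^+ and F^-. *)

Section Sobolev.
Variables (R : realType) (n : nat).
Local Notation mu := (@lebesgue_measure R).

Definition in_L2 (x : R -> 'cV[R]_n) : Prop :=
  forall i, (fun t => x t i 0) \in Lfun mu 2%:E.

(* C^1 functions with compact support, as in Brezis' definition of W^{1,p} of an
   interval; smooth test functions give the same weak derivatives. *)
Definition test_function (phi : R -> R) : Prop :=
  [/\ forall t, derivable phi t 1,
      continuous (derive1 phi)
    & compact (closure [set t | phi t != 0])].

Definition weak_derivative (x y : R -> 'cV[R]_n) : Prop :=
  forall phi, test_function phi -> forall i,
    \int[mu]_(t in [set: R]) (x t i 0 * derive1 phi t) =
    - \int[mu]_(t in [set: R]) (y t i 0 * phi t).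

(* An element of H^1 is represented by its unique continuous representative. *)
Definition in_H1 (x : R -> 'cV[R]_n) : Prop :=
  [/\ continuous x, in_L2 x & exists2 y, in_L2 y & weak_derivative x y].

(* A representative of x'; for x in H^1 it is unique up to null sets. *)
Definition wderiv (x : R -> 'cV[R]_n) : R -> 'cV[R]_n :=
  xget (fun=> 0) [set y | in_L2 y /\ weak_derivative x y].

Definition Fmap (J : 'M[R]_n) (g : R -> 'cV[R]_n -> R -> 'cV[R]_n)
    (lam : R) (x : R -> 'cV[R]_n) : R -> 'cV[R]_n :=
  fun t => J *m wderiv x t - g t (x t) lam.

(* Vanishing of F(lam, x) as an element of L^2 is vanishing a.e. *)
Definition zero_set (J : 'M[R]_n) (g : R -> 'cV[R]_n -> R -> 'cV[R]_n)
    (lam : R) : set (R -> 'cV[R]_n) :=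
  [set x | in_H1 x /\ {ae mu, forall t, Fmap J g lam x t = 0}].

End Sobolev.

Definition A_at0 (R : realType) (n : nat) (g : R -> 'cV[R]_n -> R -> 'cV[R]_n)
    (lam t : R) : 'M[R]_n := jac (fun xi => g t xi lam) 0.

Definition isolated_zero (R : realType) (n : nat) (h : 'cV[R]_n -> R) : Prop :=
  h 0 = 0 /\ \forall xi \near (0 : 'cV[R]_n), h xi = 0 -> xi = 0.

(* Main.v *)
Require Import Defs.
From HB Require Import structures.
From mathcomp Require Import all_boot all_order all_algebra.
From mathcomp Require Import all_classical all_reals all_analysis.
From mathcomp Require Import measurable_realfun ring lra.

Set Implicit Arguments.
Unset Strict Implicit.
Unset Printing Implicit Defensive.

Import Order.TTheory GRing.Theory Num.Theory.
Import numFieldNormedType.Exports.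
Local Open Scope classical_set_scope.
Local Open Scope ring_scope.

(** Let [x] be a zero of [F(lam, .)] in [H^1]. Since [J^-1 = - J], its weak
    derivative equals [z t = - J g(t, x t)] almost everywhere, and [z] is
    continuous because [g] and [x] are. A continuous function with a continuous
    weak derivative is differentiable in the ordinary sense
    ([derive_of_weak_derivative]), so [x] is a classical solution of
    [x' = - J g(t, x)]. Moreover [x] and [x'] are square integrable, which forces
    [x t] to tend to [0] as [t] tends to [+oo] and to [-oo]
    ([decay_of_derive]). The problem is thereby reduced to showing that a
    classical solution vanishing at both ends is identically [0], and each case
    has its own reason.

    (a) [V t = <x t, C x t>] has derivative [2 <g(t, x t), J C x t>], which is
    positive unless [x t = 0]. So [V] is nondecreasing and tends to [0] at both
    ends, hence is constant, hence [x = 0] ([strict_lyapunov_rigid]).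

    (b) In dimension [n], the [n + 1] translates of [x] by the multiples
    [0, Q, ..., n Q] of a multiple [Q] of the period solve one and the same
    linear system, so by uniqueness they satisfy a linear relation. At a time
    where the translate with the largest coefficient takes the value [x t], all
    the other translates are evaluated at times of modulus at least [Q - |t|],
    hence are as small as desired once [Q] is large. This is impossible unless
    [x t = 0] ([linear_periodic_rigid]).

    (c) The Hamiltonian is a first integral because [J] is skew, and its value
    along [x] is its value at the limit [0], namely [0]. As [0] is an isolated
    zero, [|x|] takes no value in some interval [(0, d)]; being continuous and
    small at infinity it stays at [0] ([first_integral_rigid]).

    Conversely [0] has to be a zero of [F(lam, .)] for whichever representative
    of the weak derivative of the zero function was selected. All of these vanish
    almost everywhere: a square integrable function orthogonal to every test
    function is [0] almost everywhere ([weakly_zero_ae]). *)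

(** * Calculus on the real line *)

Section Line.
Variable R : realType.
Local Notation mu := (@lebesgue_measure R).
Implicit Types (f df u v w : R -> R) (s t A B : R).

Lemma continuous_of_derive f df :
  (forall t, is_derive t 1 f (df t)) -> continuous f.
Proof.
move=> fd t; apply: differentiable_continuous; apply/derivable1_diffP.
exact: ex_derive.
Qed.

Lemma is_derive_add f (g : R -> R) t (a b : R) :
  is_derive t 1 f a -> is_derive t 1 g b ->
  is_derive t 1 (fun s => f s + g s) (a + b).
Proof. exact: is_deriveD. Qed.

Lemma is_derive_mul f (g : R -> R) t (a b : R) :
  is_derive t 1 f a -> is_derive t 1 g b ->
  is_derive t 1 (fun s => f s * g s) (a * g t + f t * b).
Proof.
move=> fa gb; apply: (is_derive_eq (is_deriveM fa gb)).
by rewrite /GRing.scale/= addrC [in LHS](mulrC (g t)).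
Qed.

Lemma is_derive_bigsum n (h : 'I_n -> R -> R) t (dh : 'I_n -> R) :
  (forall i, is_derive t 1 (h i) (dh i)) ->
  is_derive t 1 (fun s => \sum_i h i s) (\sum_i dh i).
Proof.
move=> hd; rewrite (_ : (fun s => _) = \sum_i h i); first exact: is_derive_sum.
by apply/funext => s; rewrite fct_sumE.
Qed.

Lemma nondecreasing_of_derive f df :
  (forall t, is_derive t 1 f (df t)) -> (forall t, 0 <= df t) ->
  forall s t, s <= t -> f s <= f t.
Proof.
move=> fd df0 s t; rewrite le_eqVlt => /predU1P[->//|st].
have [|c _ E] := MVT st (fun x _ => fd x).
  by apply/continuous_subspaceT/(continuous_of_derive fd).
by rewrite -subr_ge0 E mulr_ge0// subr_ge0 ltW.
Qed.

Lemma constant_of_derive f :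
  (forall t, is_derive t 1 f 0) -> forall s t, f s = f t.
Proof. by move=> fd s t; exact: is_derive_0_is_cst. Qed.

Lemma supported_Rintegral f A B :
  (forall t, t \notin `[A, B] -> f t = 0) ->
  \int[mu]_(t in [set: R]) f t = \int[mu]_(t in `[A, B]) f t.
Proof.
move=> f0; rewrite [RHS]Rintegral_mkcond; apply: eq_Rintegral => t _.
rewrite patchE; case: ifPn => // tAB; rewrite f0//.
by apply: contraNN tAB; rewrite inE.
Qed.

Lemma supported_integrable f A B : continuous f ->
  (forall t, t \notin `[A, B] -> f t = 0) ->
  mu.-integrable [set: R] (EFin \o f).
Proof.
move=> cf f0.
have : mu.-integrable `[A, B] (EFin \o f).
  apply: continuous_compact_integrable; first exact: segment_compact.
  exact: continuous_subspaceT.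
rewrite [X in X -> _]integrable_mkcond//; apply: eq_integrable => // t _.
rewrite patchE; case: ifPn => // tAB; rewrite /= f0//.
by apply: contraNN tAB; rewrite inE.
Qed.

(** Starting the integral at [-oo] makes the primitive bounded when [f] is
    nonnegative and integrable, and makes it vanish to the left of the support
    of [f]. *)
Definition primitive f (t : R) : R := \int[mu]_(s in `]-oo, t]) f s.

Lemma primitive_derive f : continuous f -> mu.-integrable [set: R] (EFin \o f) ->
  forall t, is_derive t 1 (primitive f) (f t).
Proof.
move=> cf intf t.
have tt : t < t + 1 by rewrite ltrDl.
have [] := @continuous_FTC1 R f -oo%O t _ tt _ _ (cf t).
- by apply: integrableS intf.
- by rewrite ltNyr.
rewrite -[X in derivable X]/(primitive f) -[X in derive1 X]/(primitive f).
by move=> dF <-; split; [exact: dF | rewrite derive1E].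
Qed.

Lemma primitive_ge0 f : (forall t, 0 <= f t) -> forall t, 0 <= primitive f t.
Proof. by move=> f0 t; apply: Rintegral_ge0. Qed.

Lemma primitive_le f : (forall t, 0 <= f t) ->
  mu.-integrable [set: R] (EFin \o f) ->
  forall t, primitive f t <= \int[mu]_(s in [set: R]) f s.
Proof.
move=> f0 intf t; rewrite /primitive Rintegral_mkcond.
apply: le_Rintegral => //.
  have : mu.-integrable `]-oo, t] (EFin \o f).
    by apply: (@integrableS _ _ _ mu [set: R]).
  by rewrite [X in X -> _]integrable_mkcond//= restrict_EFin.
by move=> s _; rewrite patchE; case: ifP.
Qed.

(** The primitive of [f] lies between [0] and the total integral, so it is
    constant. *)
Lemma ge0_Rintegral_eq0 f : continuous f ->
  mu.-integrable [set: R] (EFin \o f) -> (forall t, 0 <= f t) ->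
  \int[mu]_(s in [set: R]) f s = 0 -> forall t, f t = 0.
Proof.
move=> cf intf f0 If t.
have P0 : primitive f = cst 0.
  apply/funext => s; apply/le_anti; rewrite primitive_ge0// andbT.
  by rewrite -If primitive_le.
have := @derive_val _ _ _ _ _ _ _ (primitive_derive cf intf t).
by rewrite P0 derive_cst.
Qed.

Lemma derive_supported f df A B : (forall t, is_derive t 1 f (df t)) ->
  (forall t, t \notin `[A, B] -> f t = 0) ->
  forall t, t \notin `[A, B] -> df t = 0.
Proof.
move=> fd f0 t tAB.
rewrite -(@derive_val _ _ _ _ _ _ _ (fd t)).
have oC : open (~` [set` `[A, B]]).
  by apply: closed_openC; exact: interval_closed.
have : \forall s \near t, f s = 0.
  have /open_nbhs_nbhs : open_nbhs t (~` [set` `[A, B]]).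
    by split => //; exact/negP.
  by apply: filterS => s /= /negP; exact: f0.
move=> H; rewrite (near_eq_derive _ (g := cst 0))// ?derive_cst//.
Qed.

(** Applied to a product [Z phi] with [phi] compactly supported, this is
    integration by parts without boundary terms. *)
Lemma Rintegral_derive_supported f df A B : A < B ->
  (forall t, is_derive t 1 f (df t)) -> continuous df ->
  (forall t, t \notin `]A, B[ -> f t = 0) ->
  \int[mu]_(t in [set: R]) df t = 0.
Proof.
move=> AB fd cdf f0.
have f0' t : t \notin `[A, B] -> f t = 0.
  move=> tAB; apply: f0; apply: contraNN tAB; exact: subset_itv_oo_cc.
rewrite (@supported_Rintegral _ A B); last exact: derive_supported fd f0'.
rewrite /Rintegral (@continuous_FTC2 _ _ f)//.
- by rewrite !f0 ?subee// in_itv/= ltxx ?andbF.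
- exact: continuous_subspaceT.
- split => [x _||]; first exact: ex_derive.
  + by apply: cvg_at_right_filter; exact: continuous_of_derive fd _.
  + by apply: cvg_at_left_filter; exact: continuous_of_derive fd _.
- by move=> x _; rewrite derive1E; exact: derive_val.
Qed.

Lemma supported_test_function f df A B :
  (forall t, is_derive t 1 f (df t)) -> continuous df ->
  (forall t, t \notin `[A, B] -> f t = 0) -> test_function f.
Proof.
move=> fd cdf f0; split.
- by move=> t; exact: ex_derive.
- rewrite (_ : derive1 f = df)//; apply/funext => t; rewrite derive1E.
  exact: derive_val.
- apply: (subclosed_compact _ (@segment_compact _ A B)).
    exact: closed_closure.
  rewrite [X in _ `<=` X](_ : _ = closure [set` `[A, B]]); last first.
    by apply/closure_id; exact: interval_closed.
  apply: closure_subset => t /= /eqP ft; apply: contrapT => /negP tAB.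
  by apply: ft; exact: f0.
Qed.

End Line.

(** * Continuous weak derivatives are classical derivatives *)

Section WeakStrong.
Variable R : realType.
Local Notation mu := (@lebesgue_measure R).
Implicit Types (u v w phi dphi : R -> R) (s t A B : R).

Lemma continuousMf (T : topologicalType) (u v : T -> R) : continuous u -> continuous v ->
  continuous (fun p => u p * v p).
Proof. by move=> cu cv p; apply: cvgM; [exact: cu|exact: cv]. Qed.

Lemma continuousBf (T : topologicalType) (u v : T -> R) : continuous u -> continuous v ->
  continuous (fun p => u p - v p).
Proof. by move=> cu cv p; apply: cvgB; [exact: cu|exact: cv]. Qed.

Lemma continuousDf (T : topologicalType) (u v : T -> R) : continuous u -> continuous v ->
  continuous (fun p => u p + v p).
Proof. by move=> cu cv p; apply: cvgD; [exact: cu|exact: cv]. Qed.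

(** [plateau] localizes functions near [t0] without changing them on the support
    of [hat], which serves as a positive weight. *)
Definition plateau (t0 t : R) : R := Num.max 0 (Num.min 1 (2 - `|t - t0|)).
Definition hat (t0 t : R) : R := Num.max 0 (1 - `|t - t0|).

Lemma continuous_distf t0 (a : R) : continuous (fun t => a - `|t - t0|).
Proof.
move=> t; apply: cvgB; first exact: cvg_cst.
by apply: cvg_norm; apply: cvgB; [exact: cvg_id | exact: cvg_cst].
Qed.

Lemma continuous_plateau t0 : continuous (plateau t0).
Proof.
move=> t; apply: (@continuous_max R R (cst 0) (fun t => Num.min 1 _) t).
  exact: cvg_cst.
apply: (@continuous_min R R (cst 1) _ t); first exact: cvg_cst.
exact: continuous_distf.
Qed.

Lemma continuous_hat t0 : continuous (hat t0).
Proof.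
move=> t; apply: (@continuous_max R R (cst 0) _ t); first exact: cvg_cst.
exact: continuous_distf.
Qed.

Lemma in_ball_itv t0 e t : (t \in `[t0 - e, t0 + e]) = (`|t - t0| <= e).
Proof. by rewrite in_itv/= ler_distl. Qed.

Lemma hat_supported t0 t : t \notin `[t0 - 1, t0 + 1] -> hat t0 t = 0.
Proof.
rewrite in_ball_itv -ltNge => lt1; apply/max_idPl.
by rewrite subr_le0 ltW.
Qed.

Lemma plateau_supported t0 t : t \notin `[t0 - 2, t0 + 2] -> plateau t0 t = 0.
Proof.
rewrite in_ball_itv -ltNge => lt1; apply/max_idPl.
by rewrite ge_min subr_le0 (ltW lt1) orbT.
Qed.

Lemma plateau_eq1 t0 t : t \in `[t0 - 1, t0 + 1] -> plateau t0 t = 1.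
Proof.
rewrite in_ball_itv => le1; rewrite /plateau.
have -> : Num.min 1 (2 - `|t - t0|) = 1 :> R.
  by apply/min_idPl; rewrite lerBrDr; lra.
exact/max_idPr.
Qed.

Lemma hat_gt0 t0 t : `|t - t0| < 1 -> 0 < hat t0 t.
Proof. by move=> lt1; rewrite /hat lt_max subr_gt0 lt1 orbT. Qed.

Lemma hat_ge0 t0 t : 0 <= hat t0 t.
Proof. by rewrite le_max lexx. Qed.

(** The du Bois-Reymond lemma, in a form that only needs one test function per
    point. Let [Z] be a primitive of [v] near [t0] and [w = u - Z], so that [w]
    is orthogonal to [phi'] for every test function [phi] supported near [t0].
    Take [phi' = (w - c) rho] with a weight [rho], where [c] is the weighted mean
    of [w], which makes [phi] compactly supported. Then the integral of
    [(w - c)^2 rho] is [0], so [w = c] near [t0]. *)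
Lemma derive_of_weak_derivative u v : continuous u -> continuous v ->
  (forall phi, test_function phi ->
    \int[mu]_(t in [set: R]) (u t * derive1 phi t) =
    - \int[mu]_(t in [set: R]) (v t * phi t)) ->
  forall t, is_derive t 1 u (v t).
Proof.
move=> cu cv uv t0.
pose vb t := v t * plateau t0 t.
have cvb : continuous vb by apply: continuousMf => //; exact: continuous_plateau.
have ivb : mu.-integrable [set: R] (EFin \o vb).
  apply: (@supported_integrable _ _ (t0 - 2) (t0 + 2)) => // t tAB.
  by rewrite /vb plateau_supported// mulr0.
pose Z := primitive vb.
have dZ := primitive_derive cvb ivb.
pose w t := u t - Z t.
have cw : continuous w.
  apply: continuousBf => //; exact: continuous_of_derive dZ.
pose rho := hat t0.
have crho : continuous rho by exact: continuous_hat.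
pose A := t0 - 1; pose B := t0 + 1.
have supp (f : R -> R) t : t \notin `[A, B] -> f t * rho t = 0.
  by move=> tAB; rewrite /rho hat_supported// mulr0.
have intrho (f : R -> R) : continuous f ->
    mu.-integrable [set: R] (EFin \o (fun t => f t * rho t)).
  move=> cf; apply: (@supported_integrable _ _ A B) => //.
    exact: continuousMf.
  by move=> t tAB; rewrite supp.
pose a := \int[mu]_(t in [set: R]) (1 * rho t).
have c1 : continuous (fun _ : R => 1 : R) by move=> ?; exact: cvg_cst.
have a0 : a != 0.
  apply/eqP => /(ge0_Rintegral_eq0 _ (intrho _ c1)) H.
  suff : 1 * rho t0 = 0.
    rewrite mul1r /rho => /eqP; rewrite gt_eqF// hat_gt0//.
    by rewrite subrr normr0.
  apply: H; first exact: continuousMf.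
  by move=> t; rewrite mul1r hat_ge0.
(* [c] is the mean of [w] for the weight [rho]; it makes [psi] integrate to [0] *)
pose c := (\int[mu]_(t in [set: R]) (w t * rho t)) / a.
pose wc t := w t - c.
have cwc : continuous wc by apply: continuousBf => // ?; exact: cvg_cst.
pose psi t := wc t * rho t.
have cpsi : continuous psi by exact: continuousMf.
have ipsi : mu.-integrable [set: R] (EFin \o psi) by exact: intrho.
have psi0 t : t \notin `[A, B] -> psi t = 0 by exact: supp.
have Ipsi : \int[mu]_(t in [set: R]) psi t = 0.
  rewrite (_ : psi = fun t => w t * rho t - c * (1 * rho t)); last first.
    by apply/funext => t; rewrite /psi /wc; ring.
  rewrite RintegralB//; last 2 first.
  - exact: intrho.
  - rewrite (_ : EFin \o _ = EFin \o (fun t => c * rho t)); last first.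
      by apply/funext => t /=; rewrite mul1r.
    by apply: intrho => ?; exact: cvg_cst.
  by rewrite RintegralZl//; [rewrite /c divfK// subrr|exact: intrho].
pose phi := primitive psi.
have dphi := primitive_derive cpsi ipsi.
have phi0 t : t \notin `[A, B] -> phi t = 0.
  rewrite in_itv/= negb_and -!ltNge => /orP[tA|Bt].
    rewrite /phi /primitive (@eq_Rintegral _ _ _ _ _ (cst 0)); last first.
      move=> s; rewrite inE/= in_itv/= => st; apply: psi0.
      by rewrite in_itv/= leNgt (le_lt_trans st tA).
    by rewrite /Rintegral integral0.
  rewrite -Ipsi /phi /primitive Rintegral_mkcond; apply: eq_Rintegral => s _.
  rewrite patchE; case: ifPn => // st; rewrite psi0//.
  move: st; rewrite notin_setE/= in_itv/= => /negP; rewrite -ltNge => st.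
  by rewrite in_itv/= negb_and -!ltNge (lt_trans Bt st) orbT.
have AB : A < B by rewrite /A /B; lra.
have tphi : test_function phi by exact: supported_test_function dphi cpsi phi0.
have d1phi : derive1 phi = psi.
  by apply/funext => t; rewrite derive1E; exact: derive_val.
have cphi : continuous phi by exact: continuous_of_derive dphi.
have cZ : continuous Z by exact: continuous_of_derive dZ.
have IBP : \int[mu]_(t in [set: R]) (v t * phi t + Z t * psi t) = 0.
  apply: (@Rintegral_derive_supported _ (fun t => Z t * phi t) _ (A - 1) (B + 1)).
  - lra.
  - move=> t; have -> : v t * phi t = vb t * phi t.
      have [tAB|tAB] := boolP (t \in `[A, B]).
        by rewrite /vb plateau_eq1// mulr1.
      by rewrite phi0// !mulr0.
    exact: is_derive_mul.
  - by apply: continuousDf; exact: continuousMf.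
  - move=> t tAB; rewrite phi0 ?mulr0//; apply: contraNN tAB.
    rewrite !in_itv/= => /andP[? ?]; apply/andP; split; lra.
have ivphi : mu.-integrable [set: R] (EFin \o (fun t => v t * phi t)).
  apply: (@supported_integrable _ _ A B) => //; first exact: continuousMf.
  by move=> t tAB; rewrite phi0// mulr0.
have isupp (f : R -> R) : continuous f ->
    mu.-integrable [set: R] (EFin \o (fun t => f t * psi t)).
  move=> cf; apply: (@supported_integrable _ _ A B) => //.
    exact: continuousMf.
  by move=> t tAB; rewrite psi0// mulr0.
have Iw : \int[mu]_(t in [set: R]) (w t * psi t) = 0.
  move: (uv _ tphi) IBP; rewrite d1phi RintegralD//; last exact: isupp.
  move=> Eu EZ.
  under eq_Rintegral do rewrite mulrBl.
  rewrite RintegralB//; [|exact: isupp|exact: isupp].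
  by move: EZ; rewrite Eu -opprD => ->; rewrite oppr0.
have Iw2 : \int[mu]_(t in [set: R]) (wc t * psi t) = 0.
  under eq_Rintegral do rewrite mulrBl.
  rewrite RintegralB//; [|exact: isupp|].
    by rewrite Iw RintegralZl// Ipsi mulr0 subrr.
  by apply: isupp => ?; exact: cvg_cst.
have wc0 : forall t, wc t * psi t = 0.
  apply: ge0_Rintegral_eq0 => //; first exact: continuousMf.
    exact: isupp.
  move=> t; rewrite /psi mulrA -expr2 mulr_ge0// ?sqr_ge0//.
  exact: hat_ge0.
have uZ : \forall t \near t0, Z t + c = u t.
  near=> t.
  have : `|t - t0| < 1.
    by rewrite distrC; near: t; exact: cvgr_dist_lt.
  move/hat_gt0 => h; move: (wc0 t); rewrite /psi mulrA => /eqP.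
  rewrite mulf_eq0 (gt_eqF h) orbF mulf_eq0 orbb /wc /w => /eqP; lra.
apply: (near_eq_is_derive uZ).
have -> : v t0 = vb t0 + 0.
  by rewrite addr0 /vb plateau_eq1 ?mulr1// in_itv/=; apply/andP; split; lra.
exact: (is_derive_add (dZ t0) (is_derive_cst c t0 1)).
Unshelve. all: by end_near. Qed.

End WeakStrong.

(** * Square integrable functions orthogonal to all test functions *)

Section L2.
Variable R : realType.
Local Notation mu := (@lebesgue_measure R).
Implicit Types (y : R -> R) (a b s t e : R).

(** The function [s |-> max(0, s)^2], written as a product so that
    Caratheodory's criterion applies at [0], where it is glued. *)
Definition possq s : R := s * Num.max 0 s.

Lemma continuous_pos : continuous (fun s : R => Num.max 0 s).
Proof.
by move=> s; apply: (@continuous_max R R (cst 0) id s); [exact: cvg_cst|].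
Qed.

Lemma possq_derive s : is_derive s 1 possq (2 * Num.max 0 s).
Proof.
have [s0|s0|->] := ltrgt0P s.
- have E : \forall r \near s, r * r = possq r.
    near=> r; rewrite /possq max_r//; apply/ltW; near: r; exact: lt_nbhsr.
  apply: (near_eq_is_derive E).
  have := is_derive_mul (is_derive_id s 1) (is_derive_id s 1).
  move=> /is_derive_eq; apply; rewrite [LHS]/=; ring.
- have E : \forall r \near s, cst (0 : R) r = possq r.
    near=> r; rewrite /possq max_l ?mulr0//; apply/ltW; near: r; exact: lt_nbhsl.
  apply: (near_eq_is_derive E).
  by apply: (is_derive_eq (is_derive_cst 0 s 1)); rewrite mulr0.
- rewrite mulr0; apply/is_derive1_caratheodory.
  exists (fun r => Num.max 0 r); split; last by rewrite maxxx.
    by move=> r; rewrite /possq; ring.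
  exact: continuous_pos.
Unshelve. all: by end_near. Qed.

(** A [C^1] function that is positive exactly on the interval from [a] to [b]. *)
Definition bump a b t : R := possq ((t - a) * (b - t)).
Definition dbump a b t : R :=
  2 * Num.max 0 ((t - a) * (b - t)) * (a + b - 2 * t).

Lemma bump_derive a b t : is_derive t 1 (bump a b) (dbump a b t).
Proof.
have H : is_derive t 1 (fun s => (s - a) * (b - s)) (a + b - 2 * t).
  have h1 := is_derive_add (is_derive_id t 1) (is_derive_cst (- a) t 1).
  have h2 := is_derive_add (is_derive_cst b t 1) (is_deriveN (is_derive_id t 1)).
  apply: (is_derive_eq (is_derive_mul h1 h2)).
  rewrite /cst [(- id) t](_ : _ = - t)//; ring.
exact: (is_derive1_comp (possq_derive _) H).
Qed.

Lemma continuous_dbump a b : continuous (dbump a b).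
Proof.
have cc (c : R) : continuous (fun _ : R => c) by move=> ?; exact: cvg_cst.
have ci : continuous (fun t : R => t) by move=> ?; exact: cvg_id.
apply: continuousMf.
  apply: continuousMf; first exact: cc.
  move=> t; apply: (@continuous_comp _ _ _ (fun s => (s - a) * (b - s))).
    by apply: continuousMf; apply: continuousBf => //; exact: cc.
  exact: continuous_pos.
by apply: continuousBf; [exact: cc|apply: continuousMf => //; exact: cc].
Qed.

Lemma bump_ge0 a b t : 0 <= bump a b t.
Proof.
rewrite /bump /possq; set s := (t - a) * _; have [s0|s0] := leP 0 s.
  by rewrite mulr_ge0.
by rewrite mulr0.
Qed.

Lemma bump_gt0 a b t : a < t -> t < b -> 0 < bump a b t.
Proof.
move=> at_ tb; have h : 0 < (t - a) * (b - t) by rewrite mulr_gt0// subr_gt0.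
by rewrite /bump /possq max_r ?ltW// mulr_gt0.
Qed.

Lemma bump_supported a b t : a < b -> t \notin `]a, b[ -> bump a b t = 0.
Proof.
move=> ab; rewrite in_itv/= negb_and -!leNgt => tab.
rewrite /bump /possq max_l ?mulr0//.
case/orP: tab => h.
  by apply: mulr_le0_ge0; lra.
by apply: mulr_ge0_le0; lra.
Qed.

(** This is [bump / (bump + e)], which as [e] tends to [0] increases to the
    indicator of the open interval; the subtracted form is easier to
    differentiate. *)
Definition cutoff a b e t : R := 1 - e * (bump a b t + e)^-1.

Lemma bumpe_gt0 a b e t : 0 < e -> 0 < bump a b t + e.
Proof. by move=> e0; rewrite ltr_wpDl// bump_ge0. Qed.

Lemma cutoff_ge0 a b e t : 0 < e -> 0 <= cutoff a b e t.
Proof.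
move=> e0; rewrite subr_ge0 ler_pdivrMr ?bumpe_gt0// mul1r.
by rewrite lerDr bump_ge0.
Qed.

Lemma cutoff_le1 a b e t : 0 < e -> cutoff a b e t <= 1.
Proof.
move=> e0; rewrite lerBlDr lerDl mulr_ge0// ?(ltW e0)// invr_ge0 ltW//.
exact: bumpe_gt0.
Qed.

Lemma cutoff_supported a b e t : 0 < e -> a < b ->
  t \notin `]a, b[ -> cutoff a b e t = 0.
Proof.
by move=> e0 ab tab; rewrite /cutoff bump_supported// add0r divff ?subrr// gt_eqF.
Qed.

Definition dcutoff a b e t : R := e * dbump a b t * (bump a b t + e) ^- 2.

Lemma cutoff_derive a b e t : 0 < e ->
  is_derive t 1 (cutoff a b e) (dcutoff a b e t).
Proof.
move=> e0; have ne0 : bump a b t + e != 0 by rewrite gt_eqF// bumpe_gt0.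
have h1 := is_derive_add (bump_derive a b t) (is_derive_cst e t 1).
have h2 := is_derive_mul (is_derive_cst e t 1)
  (@is_deriveV R (fun s => bump a b s + cst e s) _ _ _ ne0 h1).
have h3 := is_derive_add (is_derive_cst (1:R) t 1) (is_deriveN h2).
apply: (is_derive_eq h3); rewrite /dcutoff /cst/= /GRing.scale/=; ring.
Qed.

Lemma continuous_cutoff a b e : 0 < e -> continuous (cutoff a b e).
Proof.
move=> e0; apply: (@continuous_of_derive _ _ (dcutoff a b e)) => t.
exact: cutoff_derive.
Qed.

Lemma continuous_dcutoff a b e : 0 < e -> continuous (dcutoff a b e).
Proof.
move=> e0; apply: continuousMf.
  apply: continuousMf; first by move=> ?; exact: cvg_cst.
  exact: continuous_dbump.
have cb : continuous (fun t => bump a b t + e).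
  apply: continuousDf; last by move=> ?; exact: cvg_cst.
  exact: continuous_of_derive (bump_derive a b).
move=> t; apply: cvgV; last by apply: cvgM; exact: cb.
by rewrite expf_neq0// gt_eqF// bumpe_gt0.
Qed.

Lemma cutoff_test_function a b e : 0 < e -> a < b ->
  test_function (cutoff a b e).
Proof.
move=> e0 ab; apply: (@supported_test_function _ _ (dcutoff a b e) a b).
- by move=> t; exact: cutoff_derive.
- exact: continuous_dcutoff.
- move=> t tab; apply: cutoff_supported => //; apply: contraNN tab.
  exact: subset_itv_oo_cc.
Qed.

Lemma cutoff_cvg a b t : a < b ->
  cutoff a b (harmonic n) t @[n --> \oo] --> (\1_(`]a, b[%classic) t : R).
Proof.
move=> ab; rewrite indicE.
have [tab|tab] := boolP (t \in `]a, b[).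
  rewrite mem_set//= -[X in _ --> X]subr0; apply: cvgB; first exact: cvg_cst.
  move: (tab); rewrite in_itv/= => /andP[at_ tb].
  have b0 := bump_gt0 at_ tb.
  rewrite -(mul0r (bump a b t + 0)^-1); apply: cvgM; first exact: cvg_harmonic.
  apply: cvgV; first by rewrite addr0 gt_eqF.
  by apply: cvgD; [exact: cvg_cst|exact: cvg_harmonic].
rewrite memNset//=; last exact/negP.
rewrite (_ : (fun n => _) = cst 0); first exact: cvg_cst.
by apply/funext => n; rewrite cutoff_supported//= invr_gt0.
Qed.

Lemma Lfun_measurable y p : y \in Lfun mu p -> measurable_fun setT y.
Proof. by rewrite inE => /andP[/[!inE]]. Qed.

(** By the inequality [|y| <= 1 + y^2]. *)
Lemma L2_integrable_compact y (A : set R) : compact A -> y \in Lfun mu 2%:E ->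
  mu.-integrable A (EFin \o y).
Proof.
move=> cA y2; have mA := compact_measurable cA.
have my := Lfun_measurable y2.
apply: (@le_integrable _ _ _ mu A mA _ (EFin \o (fun t => 1 + y t ^+ 2))) => //.
- by apply/measurable_EFinP; exact: measurable_funS my.
- move=> t _ /=; rewrite lee_fin [leRHS]ger0_norm ?addr_ge0 ?sqr_ge0//.
  have := sqr_ge0 (`|y t| - 1); rewrite -[in X in _ -> X]real_normK ?num_real//.
  have := normr_ge0 (y t); move: `|y t| => z; nra.
- rewrite (_ : EFin \o _ = (cst 1%:E \+ (EFin \o (fun t => (y t ^+ 2)%R)))%E)//.
  apply: integrableD => //.
    apply: (@continuous_compact_integrable R (cst 1)) => //.
    by apply: continuous_subspaceT => ?; exact: cvg_cst.
  apply: (@integrableS _ _ _ mu setT) => //; exact: Lfun2_integrable_sqr.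
Qed.

(** Dominated convergence along the test functions [cutoff a b e], as [e] tends
    to [0] through the harmonic sequence. *)
Lemma weakly_zero_itv y a b : y \in Lfun mu 2%:E ->
  (forall phi, test_function phi ->
     \int[mu]_(t in [set: R]) (y t * phi t) = 0) ->
  a < b -> \int[mu]_(t in `]a, b[) y t = 0.
Proof.
move=> y2 y0 ab.
have my := Lfun_measurable y2.
pose chi : R -> R := \1_(`]a, b[%classic).
pose f_ n t : \bar R := (y t * cutoff a b (harmonic n) t)%:E.
pose f t : \bar R := (y t * chi t)%:E.
have mchi : measurable_fun setT chi by exact: measurable_indic.
pose g t : R := y t * \1_(`[a, b]%classic) t.
have ig : mu.-integrable setT (EFin \o (fun t => `|g t|)).
  apply: integrable_norm.
  have := @L2_integrable_compact y _ (@segment_compact _ a b) y2.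
  rewrite [X in X -> _]integrable_mkcond//; apply: eq_integrable => // t _.
  rewrite patchE /g /= indicE; case: ifPn => tab; first by rewrite mulr1.
  by rewrite mulr0.
have mf_ n : measurable_fun setT (f_ n).
  apply/measurable_EFinP; apply: measurable_funM => //.
  apply: (@continuous_measurable_fun R).
  by apply: continuous_cutoff; rewrite invr_gt0.
have f_g n t : (`|f_ n t| <= (`|g t|)%:E)%E.
  rewrite /f_ /= lee_fin !normrM ler_wpM2l//.
  have e0 : (0 : R) < harmonic n by rewrite invr_gt0.
  rewrite ger0_norm ?cutoff_ge0// indicE.
  have [tab|tab] := boolP (t \in `[a, b]).
    by rewrite mem_set//= normr1 cutoff_le1.
  rewrite cutoff_supported//; apply: contraNN tab; exact: subset_itv_oo_cc.
have If_ n : (\int[mu]_t f_ n t = 0)%E.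
  have tf : test_function (cutoff a b (harmonic n)).
    by apply: cutoff_test_function => //=; rewrite invr_gt0.
  rewrite -[LHS]fineK; first by congr EFin; exact: y0 tf.
  apply: integrable_fin_num => //.
  apply: (@le_integrable _ _ _ mu setT measurableT _ _ (mf_ n) _ ig) => t _.
  by rewrite [leRHS]gee0_abs ?lee_fin//; exact: f_g.
have [||||_ _] := @dominated_convergence _ _ R mu setT measurableT f_ f
    (EFin \o (fun t => `|g t|)) mf_.
- by apply/measurable_EFinP; exact: measurable_funM.
- apply: aeW => t _; apply: cvg_EFin; first exact: nearW.
  by apply: cvgM; [exact: cvg_cst|exact: cutoff_cvg].
- exact: ig.
- by apply: aeW => t n _; exact: f_g.
rewrite (_ : [sequence _]_n = cst 0%E); last by apply/funext => n; exact: If_.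
move=> /cvg_lim; rewrite lim_cst// => /(_ (@ereal_hausdorff R)) E.
rewrite Rintegral_mkcond.
rewrite (_ : y \_ _ = fun t => y t * chi t); last first.
  apply/funext => t; rewrite patchE /chi indicE; case: ifP; rewrite ?mulr1 ?mulr0//.
by rewrite /Rintegral -E.
Qed.

(** The integrals of [y] over bounded intervals vanish, and by Lebesgue's
    differentiation theorem [y] is almost everywhere the derivative of such an integral. *)
Lemma weakly_zero_ae y : y \in Lfun mu 2%:E ->
  (forall phi, test_function phi ->
     \int[mu]_(t in [set: R]) (y t * phi t) = 0) ->
  {ae mu, forall t, y t = 0}.
Proof.
move=> y2 y0; have my := Lfun_measurable y2.
have locy : locally_integrable [set: R] y.
  split => //; first exact: openT.
  by move=> K _ cK; have /integrableP[] := L2_integrable_compact cK y2.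
suff H (n : nat) : {ae mu, forall t, - n%:R < t -> y t = 0}.
  have := ae_foralln H.
  apply: filterS => t Ht.
  apply: (Ht (Num.truncn `|t|).+1).
  by rewrite ltrNl (le_lt_trans (ler_norm _))// normrN truncnS_gt.
have := @FTC1 R y (BLeft (- n%:R)) _ locy.
have F0 : (fun x => \int[mu]_(t in
    [set` Interval (BLeft (- n%:R)) (BRight x)]) y t) = cst 0.
  apply/funext => x /=.
  have [nx|xn] := ltP (- n%:R) x; last first.
    move: xn; rewrite le_eqVlt => /predU1P[->|xn].
      by rewrite set_itv1 Rintegral_set1.
    by rewrite set_itv_ge ?Rintegral_set0// bnd_simp -ltNge.
  rewrite -Rintegral_itv_bndo_bndc; last first.
    apply: (@integrableS _ _ _ mu `[- n%:R, x]) => //.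
      exact: subset_itv_co_cc.
    by apply: L2_integrable_compact => //; exact: segment_compact.
  rewrite -Rintegral_itv_obnd_cbnd; last first.
    apply: (@integrableS _ _ _ mu `[- n%:R, x]) => //.
      exact: subset_itv_oo_cc.
    by apply: L2_integrable_compact => //; exact: segment_compact.
  exact: weakly_zero_itv.
rewrite F0 => H; have {}H := H _.
have : forall z, mu.-integrable [set` Interval (BLeft (- n%:R)) (BRight z)] (EFin \o y).
  by move=> z; apply: L2_integrable_compact => //; exact: segment_compact.
move=> /H; apply: filterS; first exact: (ae_filter_ringOfSetsType mu).
move=> t /= + nt => /(_ _)[|_ <-].
  by rewrite lte_fin.
by rewrite derive1E derive_cst.
Qed.
End L2.

(** * Decay of H^1 functions *)

Section Decay.
Variable R : realType.
Local Notation mu := (@lebesgue_measure R).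
Implicit Types (u v : R -> R) (s t e T : R).

(** Let [G] be a bounded primitive of [u^2 + v^2]. As [(u^2)' = 2 u v] is at
    least [- G'], the sum [u^2 + G] is nondecreasing. On a unit interval starting
    at [t] the mean value theorem gives a point [c] with
    [u(c)^2 <= G'(c) = G(t + 1) - G(t)], and going back from [c] to [t] yields
    [u(t)^2 <= 2 (G(t + 1) - G(t))]. The right-hand side tends to [0] at both
    ends since [G] is monotone and bounded. *)
Lemma decay_of_derive u v :
  (forall t, is_derive t 1 u (v t)) -> continuous v ->
  mu.-integrable [set: R] (EFin \o (fun t => u t ^+ 2)) ->
  mu.-integrable [set: R] (EFin \o (fun t => v t ^+ 2)) ->
  forall e, 0 < e -> exists T, forall t, T <= `|t| -> `|u t| < e.
Proof.
move=> du cv iu iv e e0.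
have cu : continuous u by exact: continuous_of_derive du.
pose f t := u t * u t + v t * v t.
have f0 t : 0 <= f t by rewrite /f -!expr2 addr_ge0// sqr_ge0.
have cf : continuous f by apply: continuousDf; exact: continuousMf.
have intf : mu.-integrable [set: R] (EFin \o f).
  rewrite (_ : EFin \o f =
    ((EFin \o (fun t => (u t ^+ 2)%R)) \+ (EFin \o (fun t => (v t ^+ 2)%R)))%E).
    exact: integrableD.
  by apply/funext => t; rewrite /f/= -!expr2 -EFinD.
pose G := primitive f.
have dG := primitive_derive cf intf.
have Gnd := nondecreasing_of_derive dG f0.
(* [u ^ 2 + G] is nondecreasing because [2 u v >= - (u ^ 2 + v ^ 2)]. *)
have mono s t : s <= t -> u s * u s + G s <= u t * u t + G t.
  apply: (@nondecreasing_of_derive _ (fun r => u r * u r + G r)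
    (fun r => v r * u r + u r * v r + f r)) => r.
    exact: is_derive_add (is_derive_mul (du r) (du r)) (dG r).
  rewrite /f; have := sqr_ge0 (u r + v r); nra.
have key t : u t * u t <= 2 * (G (t + 1) - G t).
  have tt : t < t + 1 by rewrite ltrDl.
  have [|c ct E] := MVT tt (fun x _ => dG x).
    by apply/continuous_subspaceT/(continuous_of_derive dG).
  move: ct; rewrite in_itv/= => /andP[tc ct].
  have {}E : G (t + 1) - G t = f c by rewrite E addrC addKr mulr1.
  have fc : u c * u c <= f c by rewrite lerDl -expr2 sqr_ge0.
  have := mono _ _ (ltW tc); have := Gnd _ _ (ltW ct); rewrite -/G; lra.
have Gs : has_sup (range G).
  split; first by exists (G 0), 0.
  by exists (\int[mu]_(s in [set: R]) f s) => _ [t _ <-]; exact: primitive_le.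
have Gi : has_inf (range G).
  split; first by exists (G 0), 0.
  by exists 0 => _ [t _ <-]; exact: primitive_ge0.
pose d := e ^+ 2 / 4.
have d0 : 0 < d by rewrite divr_gt0// exprn_gt0.
have [_ [T1 _ <-] GT1] := sup_adherent d0 Gs.
have [_ [T0 _ <-] GT0] := inf_adherent d0 Gi.
have small t : G (t + 1) - G t < d -> `|u t| < e.
  move=> Gd; rewrite -(ltr_pXn2r (n := 2))// ?nnegrE ?(ltW e0)//.
  rewrite real_normK ?num_real// expr2.
  by have := key t; have := exprn_gt0 2 e0; move: Gd; rewrite /d; lra.
exists (`|T1| + `|T0| + 1) => t Tt; apply: small.
have [t0|t0] := leP 0 t.
  rewrite (ger0_norm t0) in Tt.
  have T1t : T1 <= t by have := ler_norm T1; have := normr_ge0 T0; lra.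
  have := Gnd _ _ T1t.
  have : G (t + 1) <= sup (range G) by apply: sup_upper_bound => //; exists (t + 1).
  by move: GT1; rewrite /G; lra.
rewrite (ltr0_norm t0) in Tt.
have tT0 : t + 1 <= T0.
  by have := ler_norm (- T0); rewrite normrN; have := normr_ge0 T1; lra.
have := Gnd _ _ tT0.
have : inf (range G) <= G t by apply: ge_inf; [case: Gi|exists t].
by move: GT0; rewrite /G; lra.
Qed.

End Decay.

(** * From weak to classical derivatives in H^1 *)

Section SobolevZeros.
Variables (R : realType) (n : nat).
Local Notation mu := (@lebesgue_measure R).
Implicit Types (x z : R -> 'cV[R]_n).

Lemma wderivP x : in_H1 x -> in_L2 (wderiv x) /\ weak_derivative x (wderiv x).
Proof.
move=> [_ _ [y y2 xy]].
have : exists y, [set y | in_L2 y /\ weak_derivative x y] y by exists y.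
by move/(xgetPex (fun=> 0)).
Qed.

Lemma in_H1_zero : in_H1 (fun=> 0 : 'cV[R]_n).
Proof.
have L0 : in_L2 (fun=> 0 : 'cV[R]_n).
  move=> i; rewrite (_ : (fun=> _) = 0); last by apply/funext => t; rewrite mxE.
  exact: (Lfun_submod_closed mu (lee1n 2)).1.
split => //; first by move=> t; exact: cvg_cst.
exists (fun=> 0) => // phi _ i.
under eq_Rintegral do rewrite mxE mul0r.
under [in RHS]eq_Rintegral do rewrite mxE mul0r.
by rewrite /Rintegral integral0 oppr0.
Qed.

(** The selected weak derivative of [0] is only known to be some square
    integrable function orthogonal to all test functions. *)
Lemma wderiv_zero : {ae mu, forall t, wderiv (fun=> 0 : 'cV[R]_n) t = 0}.
Proof.
have [y2 wy] := wderivP in_H1_zero.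
have H (i : 'I_n) : {ae mu, forall t, wderiv (fun=> 0 : 'cV[R]_n) t i 0 = 0}.
  apply: weakly_zero_ae; first exact: y2.
  move=> phi tphi; have := wy phi tphi i.
  under eq_Rintegral do rewrite mxE mul0r.
  by rewrite {1}/Rintegral integral0 => /eqP; rewrite eq_sym oppr_eq0 => /eqP.
have := filter_forall (ae_filter_ringOfSetsType mu) H.
apply: filterS => t Ht; apply/matrixP => i j; rewrite mxE ord1; exact: Ht.
Qed.

Lemma H1_classical x z : in_H1 x -> (forall i, continuous (fun t => z t i 0)) ->
  {ae mu, forall t, wderiv x t = z t} ->
  forall i : 'I_n, [/\ forall t : R, is_derive t 1 (fun s => x s i 0) (z t i 0),
    mu.-integrable [set: R] (EFin \o (fun t => (x t i 0) ^+ 2)) &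
    mu.-integrable [set: R] (EFin \o (fun t => (z t i 0) ^+ 2))].
Proof.
move=> xH1 cz xz i; have [y2 xy] := wderivP xH1; have [cx x2 _] := xH1.
have mz : measurable_fun setT (fun t => z t i 0).
  exact: continuous_measurable_fun (cz i).
have my := Lfun_measurable (y2 i).
have cxi : continuous (fun t => x t i 0).
  move=> t; apply: (@continuous_comp _ _ _ x (fun M : 'cV[R]_n => M i 0)).
    exact: cx.
  exact: coord_continuous.
split; last 2 first.
- exact: Lfun2_integrable_sqr (x2 i).
- have /integrableP[my2 fy] := Lfun2_integrable_sqr (y2 i).
  apply/integrableP; split.
    by apply/measurable_EFinP; exact: measurable_funX.
  apply: le_lt_trans fy; rewrite le_eqVlt; apply/orP; left; apply/eqP.
  apply: ae_eq_integral => //.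
  - by do 2 apply: measurableT_comp => //; exact: measurable_funX.
  - exact: measurableT_comp.
  - apply: filterS xz; first exact: (ae_filter_ringOfSetsType mu).
    by move=> t /= -> _.
apply: derive_of_weak_derivative => // phi tphi.
rewrite (xy phi tphi i); congr (- _); rewrite /Rintegral; congr fine.
have mphi : measurable_fun setT phi.
  apply: (@continuous_measurable_fun R) => t; apply: differentiable_continuous.
  by apply/derivable1_diffP; case: tphi.
apply: ae_eq_integral => //.
- by apply/measurable_EFinP; exact: measurable_funM.
- by apply/measurable_EFinP; exact: measurable_funM.
- apply: filterS xz; first exact: (ae_filter_ringOfSetsType mu).
  by move=> t /= -> _.
Qed.

End SobolevZeros.

(** * Curves and their coordinatewise derivatives *)

Section Dot.
Variables (R : realType) (n : nat).
Implicit Types (u v w : 'cV[R]_n) (A : 'M[R]_n).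

Lemma dotvE u v : dotv u v = (u^T *m v) 0 0.
Proof. by rewrite mxE; apply: eq_bigr => i _; rewrite mxE. Qed.

Lemma dotvC u v : dotv u v = dotv v u.
Proof. by apply: eq_bigr => i _; rewrite mulrC. Qed.

Lemma dotv_mulmx A u v : dotv (A *m u) v = dotv u (A^T *m v).
Proof. by rewrite !dotvE trmx_mul mulmxA. Qed.

Lemma dotvNr u v : dotv u (- v) = - dotv u v.
Proof. by rewrite -sumrN; apply: eq_bigr => i _; rewrite mxE mulrN. Qed.

Lemma dotv_skew A u : A^T = - A -> dotv (A *m u) u = 0.
Proof.
move=> AT; have := dotv_mulmx A u u.
by rewrite AT mulNmx dotvNr [X in _ = - X]dotvC => E; lra.
Qed.

Lemma dotv_eq0 u : dotv u u <= 0 -> u = 0.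
Proof.
move=> u0; have : dotv u u == 0.
  by rewrite eq_le u0 sumr_ge0// => i _; rewrite -expr2 sqr_ge0.
rewrite psumr_eq0 => [/allP H|i _]; last by rewrite -expr2 sqr_ge0.
apply/colP => i; rewrite mxE; apply/eqP; rewrite -sqrf_eq0 expr2.
by apply: H; rewrite mem_index_enum.
Qed.

End Dot.

Section Curves.
Variables (R : realType) (n : nat).
Implicit Types (x z : R -> 'cV[R]_n) (A : 'M[R]_n).

Definition has_derivative x z :=
  forall (i : 'I_n) (t : R), is_derive t 1 (fun s => x s i 0) (z t i 0).

Lemma has_derivative_dotv x z (y w : R -> 'cV[R]_n) :
  has_derivative x z -> has_derivative y w ->
  forall t : R, is_derive t 1 (fun s => dotv (x s) (y s))
    (dotv (z t) (y t) + dotv (x t) (w t)).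
Proof.
move=> xz yw t; rewrite /dotv -big_split/=.
by apply: is_derive_bigsum => i; exact: is_derive_mul.
Qed.

Lemma has_derivative_mulmx A x z : has_derivative x z ->
  has_derivative (fun t => A *m x t) (fun t => A *m z t).
Proof.
move=> xz i t; rewrite mxE.
rewrite (_ : (fun s => _) = (fun s => \sum_j A i j * x s j 0)); last first.
  by apply/funext => s; rewrite mxE.
apply: is_derive_bigsum => j.
have := is_derive_mul (is_derive_cst (A i j) t 1) (xz j t).
by move=> /is_derive_eq; apply; rewrite mul0r add0r.
Qed.

Lemma has_derivative_comb m (a : 'I_m -> R) (xs zs : 'I_m -> R -> 'cV[R]_n) :
  (forall k, has_derivative (xs k) (zs k)) ->
  has_derivative (fun t => \sum_k a k *: xs k t) (fun t => \sum_k a k *: zs k t).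
Proof.
move=> xz i t; rewrite summxE.
rewrite (_ : (fun s => _) = (fun s => \sum_k a k * xs k s i 0)); last first.
  by apply/funext => s; rewrite summxE; apply: eq_bigr => k _; rewrite mxE.
apply: is_derive_bigsum => k; rewrite mxE.
have := is_derive_mul (is_derive_cst (a k) t 1) (xz k i t).
by move=> /is_derive_eq; apply; rewrite mul0r add0r.
Qed.

Lemma has_derivative_shift (c : R) x z : has_derivative x z ->
  has_derivative (fun t => x (t + c)) (fun t => z (t + c)).
Proof.
move=> xz i t.
have h := is_derive_add (is_derive_id t 1) (is_derive_cst c t 1).
have H : is_derive t 1 (fun s => x (s + c) i 0) (z (t + c) i 0 * (1 + 0)).
  exact: (@is_derive1_comp R (fun s => x s i 0) (fun s => s + c) t _ _
    (xz i (t + c)) h).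
by apply: (is_derive_eq H); rewrite addr0 mulr1.
Qed.

Lemma has_derivative_differentiable x z t : has_derivative x z ->
  differentiable x t /\ 'D_1 x t = z t.
Proof.
move=> xz; have dx : derivable x t 1.
  by apply/derivable_mxP => i j; rewrite ord1; apply: ex_derive; exact: xz.
split; first exact/derivable1_diffP.
rewrite derive_mx//; apply/colP => i; rewrite mxE.
exact: (@derive_val _ _ _ _ _ _ _ (xz i t)).
Qed.

Lemma has_derivative_continuous x z : has_derivative x z -> continuous x.
Proof.
move=> xz t; apply: differentiable_continuous.
by have [] := has_derivative_differentiable t xz.
Qed.

(** Chain rule; [grad h] collects the partial derivatives, so the total
    derivative of [h] is recovered from it by linearity. *)
Lemma has_derivative_comp x z (h : 'cV[R]_n -> R) : has_derivative x z ->
  (forall xi, differentiable h xi) ->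
  forall t : R, is_derive t 1 (h \o x) (dotv (z t) (grad h (x t))).
Proof.
move=> xz dh t.
have [dx Dx] := has_derivative_differentiable t xz.
have dhx : differentiable (h \o x) t by exact: differentiable_comp.
split; first exact/derivable1_diffP.
rewrite deriveE// diff_comp//= -(deriveE _ dx) Dx.
rewrite {1}(_ : z t = \sum_j z t j 0 *: delta_mx j 0); last first.
  rewrite [LHS]matrix_sum_delta; apply: eq_bigr => j _.
  by rewrite big_ord1.
rewrite linear_sum/dotv; apply: eq_bigr => j _.
by rewrite linearZ/= mxE /pderiv -deriveE.
Qed.

Lemma vanishing_cvg x (F : set_system R) {FF : Filter F} :
  (forall e : R, 0 < e -> \forall t \near F, forall i, `|x t i 0| < e) ->
  x @ F --> (0 : 'cV[R]_n).
Proof.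
move=> xF; apply/cvg_ballP => e e0; apply: filterS (xF _ e0) => t xt.
split => // i j; rewrite mxE ord1 /ball/= sub0r normrN; exact: xt.
Qed.

End Curves.

(** * Solutions of linear systems *)

Section LinearODE.
Variables (R : realType) (n : nat).
Implicit Types (y : R -> 'cV[R]_n) (B : R -> 'M[R]_n).

Lemma continuous_bigsum m (f : 'I_m -> R -> R) :
  (forall i, continuous (f i)) -> continuous (fun t => \sum_i f i t).
Proof. by move=> cf; apply: continuous_big => //; exact: add_continuous. Qed.

Lemma exp_derive (L t : R) : is_derive t 1 (fun s => expR (L * s)) (L * expR (L * t)).
Proof.
have h : is_derive t 1 (fun s => L * s) L.
  apply: (is_derive_eq (is_derive_mul (is_derive_cst L t 1) (is_derive_id t 1))).
  by rewrite mul0r add0r mulr1.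
rewrite mulrC.
exact: (@is_derive1_comp R expR (fun s => L * s) t _ _ (is_derive_expR (L * t)) h).
Qed.

(** From [2 |v_i v_j| <= v_i^2 + v_j^2 <= 2 |v|^2]. *)
Lemma mxform_bound (M : 'M[R]_n) (v : 'cV[R]_n) :
  `|dotv (M *m v) v + dotv v (M *m v)| <=
  (2 * \sum_i \sum_j `|M i j|) * dotv v v.
Proof.
rewrite [dotv v (M *m v)]dotvC -mulr2n -[X in `|X|]mulr_natl normrM normr_nat -mulrA.
rewrite ler_pM2l//.
have vle i : v i 0 ^+ 2 <= dotv v v.
  rewrite /dotv (bigD1 i)//= -expr2 lerDl sumr_ge0// => j _.
  by rewrite -expr2 sqr_ge0.
rewrite {1}/dotv mulr_suml; apply: le_trans (ler_norm_sum _ _ _) _.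
apply: ler_sum => i _; rewrite mxE !mulr_suml.
apply: le_trans (ler_norm_sum _ _ _) _; apply: ler_sum => j _.
rewrite -mulrA normrM ler_wpM2l// normrM.
have := vle i; have := vle j; have := sqr_ge0 (`|v j 0| - `|v i 0|).
rewrite -[v i 0 ^+ 2]real_normK ?num_real// -[v j 0 ^+ 2]real_normK ?num_real//.
rewrite !expr2; lra.
Qed.

(** Gronwall's argument: [u = |y|^2] satisfies [|u'| <= L u] on the compact
    interval between [- |t|] and [|t|], so [u s * exp (- L s)] decreases from its
    value [0] at [0] when [t > 0], and [u s * exp (L s)] increases to it when
    [t < 0]. *)
Lemma linear_ode_unique y B : (forall i j, continuous (fun t => B t i j)) ->
  has_derivative y (fun t => B t *m y t) -> y 0 = 0 -> forall t, y t = 0.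
Proof.
move=> cB yB y0.
pose u t := dotv (y t) (y t).
pose du t := dotv (B t *m y t) (y t) + dotv (y t) (B t *m y t).
have dud (t : R) : is_derive t 1 u (du t) by exact: (has_derivative_dotv yB yB).
pose beta (t : R) := 2 * \sum_i \sum_j `|B t i j|.
have cbeta : continuous beta.
  apply: continuousMf; first by move=> ?; exact: cvg_cst.
  apply: (@continuous_bigsum _ (fun i t => \sum_j `|B t i j|)) => i.
  apply: (@continuous_bigsum _ (fun j t => `|B t i j|)) => j t.
  by apply: cvg_norm; exact: cB.
have u_ge0 t : 0 <= u t by apply: sumr_ge0 => i _; rewrite -expr2 sqr_ge0.
have u0 : u 0 = 0 by rewrite /u y0 /dotv big1// => i _; rewrite mxE mul0r.
move=> t; apply: dotv_eq0; rewrite -/(u t).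
have [c _ Lmax] : exists2 c, c \in `[- `|t|, `|t|] &
    forall s, s \in `[- `|t|, `|t|] -> beta s <= beta c.
  apply: EVT_max; last exact: continuous_subspaceT.
  by rewrite (@le_trans _ _ 0) ?oppr_le0.
set L := beta c in Lmax.
have bound s : s \in `[- `|t|, `|t|] -> `|du s| <= L * u s.
  move=> st; apply: (le_trans (mxform_bound _ _)).
  by rewrite ler_wpM2r ?u_ge0 ?Lmax.
have wd (K s : R) : is_derive s 1 (fun r => u r * expR (K * r))
    ((du s + K * u s) * expR (K * s)).
  apply: (is_derive_eq (is_derive_mul (dud s) (exp_derive K s))); ring.
have cw K : continuous (fun r => u r * expR (K * r)).
  exact: continuous_of_derive (wd K).
have [t0|t0|->] := ltrgt0P t; last by rewrite u0.
  have [|r rt] := MVT t0 (fun r _ => wd (- L) r).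
    exact: continuous_subspaceT.
  rewrite u0 mul0r !subr0 => E.
  have : u t * expR (- L * t) <= 0.
    rewrite E; apply: mulr_le0_ge0; last exact: ltW.
    apply: mulr_le0_ge0; last exact: expR_ge0.
    have := bound r; rewrite gtr0_norm// => /(_ _) /[!ler_norml] H.
    have /H : r \in `[- t, t].
      by move: rt; rewrite !in_itv/= => /andP[? ?]; apply/andP; split; lra.
    by move=> /andP[_]; rewrite mulNr subr_le0.
  by rewrite pmulr_lle0 ?expR_gt0.
have [|r rt] := MVT t0 (fun r _ => wd L r).
  exact: continuous_subspaceT.
rewrite u0 mul0r !sub0r => E.
have : u t * expR (L * t) <= 0.
  rewrite -oppr_ge0 E; apply: mulr_ge0; last by rewrite oppr_ge0 ltW.
  apply: mulr_ge0; last exact: expR_ge0.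
  have := bound r; rewrite ltr0_norm// => /(_ _) /[!ler_norml] H.
  have /H : r \in `[- - t, - t].
    by move: rt; rewrite !in_itv/= => /andP[? ?]; apply/andP; split; lra.
  by move=> /andP[+ _]; rewrite -subr_ge0 opprK.
by rewrite pmulr_lle0 ?expR_gt0.
Qed.

End LinearODE.

(** * Solutions vanishing at both ends are trivial *)

Section Rigidity.
Variables (R : realType) (n : nat).
Implicit Types (x z : R -> 'cV[R]_n).

Definition vanishing_at_infinity x := forall e : R, 0 < e ->
  exists T : R, forall t, T <= `|t| -> forall i, `|x t i 0| < e.

Lemma vanishing_cvgy x : vanishing_at_infinity x -> x @ +oo --> (0 : 'cV[R]_n).
Proof.
move=> vx; apply: vanishing_cvg => e /vx[T xT]; near=> t; apply: xT.
by apply: le_trans (ler_norm _); near: t; apply: nbhs_pinfty_ge; exact: num_real.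
Unshelve. all: by end_near. Qed.

Lemma vanishing_cvgNy x : vanishing_at_infinity x -> x @ -oo --> (0 : 'cV[R]_n).
Proof.
move=> vx; apply: vanishing_cvg => e /vx[T xT]; near=> t; apply: xT.
rewrite -normrN; apply: le_trans (ler_norm _); rewrite lerNr.
by near: t; apply: nbhs_ninfty_le; exact: num_real.
Unshelve. all: by end_near. Qed.

Lemma continuous_coord (i : 'I_n) : continuous (fun v : 'cV[R]_n => v i 0).
Proof. exact: coord_continuous. Qed.

Lemma continuous_mulmx (C : 'M[R]_n) (i : 'I_n) :
  continuous (fun v : 'cV[R]_n => (C *m v) i 0).
Proof.
rewrite (_ : (fun v : 'cV[R]_n => _) = fun v => \sum_j C i j * v j 0).
  apply: (@continuous_big _ _ _ _ _ (@add_continuous _)) => j _.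
  by apply: continuousMf; [exact: cst_continuous|exact: continuous_coord].
by apply/funext => v; rewrite mxE.
Qed.

Lemma continuous_mxform (C : 'M[R]_n) :
  continuous (fun v : 'cV[R]_n => dotv v (C *m v)).
Proof.
apply: (@continuous_big _ _ _ _ _ (@add_continuous _)) => i _.
by apply: continuousMf; [exact: continuous_coord|exact: continuous_mulmx].
Qed.

(** The quadratic form of [C] increases strictly along [x] outside [0], but has
    the same limit [0] at both ends. *)
Lemma strict_lyapunov_rigid x z (C : 'M[R]_n) : has_derivative x z ->
  vanishing_at_infinity x -> C^T = C ->
  (forall t, x t != 0 -> 0 < dotv (z t) (C *m x t)) -> forall t, x t = 0.
Proof.
move=> xz vx CT pos.
pose V t := dotv (x t) (C *m x t).
pose dV t := dotv (z t) (C *m x t) + dotv (x t) (C *m z t).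
have dVd (t : R) : is_derive t 1 V (dV t).
  exact: (has_derivative_dotv xz (has_derivative_mulmx C xz)).
have dVE t : dV t = 2 * dotv (z t) (C *m x t).
  by rewrite /dV -[X in _ + dotv (x t) (X *m _)]CT -dotv_mulmx dotvC; ring.
have dV0 t : 0 <= dV t.
  rewrite dVE mulr_ge0//; have [->|/pos/ltW//] := eqVneq (x t) 0.
  by rewrite mulmx0 /dotv big1// => i _; rewrite mxE mulr0.
have Vnd := nondecreasing_of_derive dVd dV0.
have q0 : dotv (0 : 'cV[R]_n) (C *m 0) = 0.
  by rewrite /dotv big1// => i _; rewrite mxE mul0r.
have V0 : V = cst 0.
  apply/funext => t; apply/le_anti/andP; split; rewrite leNgt; apply/negP => Vt.
    have cV : V s @[s --> +oo] --> (0 : R).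
      rewrite -q0; apply: (@cvg_comp _ _ _ x (fun v => dotv v (C *m v))).
        exact: vanishing_cvgy.
      exact: continuous_mxform.
    have : \forall s \near +oo, V s < V t /\ t <= s.
      near=> s; split; near: s; first exact: cvgr_lt Vt.
      by apply: nbhs_pinfty_ge; exact: num_real.
    case/filter_ex => s [].
    by move=> + /Vnd; rewrite ltNge => /negP.
  have cV : V s @[s --> -oo] --> (0 : R).
    rewrite -q0; apply: (@cvg_comp _ _ _ x (fun v => dotv v (C *m v))).
      exact: vanishing_cvgNy.
    exact: continuous_mxform.
  have : \forall s \near -oo, V t < V s /\ s <= t.
    near=> s; split; near: s; first exact: cvgr_gt Vt.
    by apply: nbhs_ninfty_le; exact: num_real.
  case/filter_ex => s [].
  by move=> + /Vnd; rewrite ltNge => /negP.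
move=> t; apply/eqP; apply/negPn/negP => /pos.
have := @derive_val _ _ _ _ _ _ _ (dVd t).
by rewrite V0 derive_cst dVE; lra.
Unshelve. all: by end_near. Qed.

(** The function [h] is constant along [x], equal to its limit [h 0 = 0]. Hence
    [|x|] avoids an interval with left end [0], and the intermediate value
    theorem keeps it from leaving [0]. *)
Lemma first_integral_rigid x z (h : 'cV[R]_n -> R) : has_derivative x z ->
  vanishing_at_infinity x -> (forall xi, differentiable h xi) ->
  (forall t, dotv (z t) (grad h (x t)) = 0) -> isolated_zero h ->
  forall t, x t = 0.
Proof.
move=> xz vx dh zh [h0 iso].
have hx (t : R) : is_derive t 1 (h \o x) 0.
  by rewrite -[X in is_derive _ _ _ X](zh t); exact: has_derivative_comp.
have hx0 t : h (x t) = 0.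
  have cst_h : h \o x = cst (h (x t)).
    by apply/funext => s; exact: constant_of_derive hx s t.
  have : (h \o x) s @[s --> +oo] --> h 0.
    apply: (@cvg_comp _ _ _ x h); first exact: vanishing_cvgy.
    exact: (differentiable_continuous (dh 0)).
  by rewrite cst_h => /(cvg_unique _ (cvg_cst _)) ->.
have [d /= d0 iso'] : exists2 d : R, 0 < d &
    forall xi : 'cV[R]_n, `|xi| < d -> h xi = 0 -> xi = 0.
  move/nbhs_ballP : iso => [d /= d0 Bd]; exists d => // xi xid; apply: Bd.
  by rewrite -ball_normE/= sub0r normrN.
have xd t : `|x t| < d -> x t = 0 by move=> xt; apply: iso'.
have cx : continuous (fun t => `|x t|).
  by move=> t; apply: cvg_norm; exact: has_derivative_continuous xz t.
move=> t; apply/xd; rewrite ltNge; apply/negP => dt.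
have d20 : 0 < d / 2 by rewrite divr_gt0.
have [s [st sd]] : exists s, t <= s /\ `|x s| < d / 2.
  have : \forall s \near +oo, t <= s /\ `|x s| < d / 2.
    near=> s; split; near: s.
      by apply: nbhs_pinfty_ge; exact: num_real.
    by apply: (cvgr_norm_lt _ (vanishing_cvgy vx)); rewrite normr0.
  by case/filter_ex => s; exists s.
have [||r _ xr] := @IVT R (fun t => `|x t|) t s (d / 2) st.
- exact: continuous_subspaceT.
- by rewrite ge_min le_max (ltW sd) orbT /=; apply/orP; left; lra.
have : x r = 0 by apply/xd; rewrite xr; lra.
by move=> E; move: xr; rewrite E normr0; lra.
Unshelve. all: by end_near. Qed.

Lemma left_kernel_nonzero m (M : 'M[R]_(m.+1, m)) :
  exists2 a : 'rV[R]_m.+1, a != 0 & a *m M = 0.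
Proof.
have : kermx M != 0.
  by rewrite kermx_eq0 /row_free ltn_eqF// ltnS rank_leq_col.
by move=> /rowV0Pn[a /sub_kermxP aM a0]; exists a.
Qed.

(** The [n + 1] translates of [x] by multiples of [Q] are solutions in dimension
    [n], hence linearly dependent. If [Q] is large, at the time when the translate
    with the largest coefficient equals [x t] the others are too small to
    compensate it. *)
Lemma linear_periodic_rigid x (B : R -> 'M[R]_n) (P : R) :
  (forall i j, continuous (fun t => B t i j)) -> 0 < P ->
  (forall t, B (t + P) = B t) ->
  has_derivative x (fun t => B t *m x t) -> vanishing_at_infinity x ->
  forall t, x t = 0.
Proof.
move=> cB P0 BP xB vx t; apply/colP => i; rewrite mxE; apply/eqP.
apply/negPn/negP => xt0.
pose d := `|x t i 0|.
have d0 : 0 < d by rewrite normr_gt0.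
(* [n] terms, each below [d / (n + 1)], cannot add up to [d] *)
have [T xT] := vx (d / n.+1%:R) (divr_gt0 d0 (ltr0Sn _ _)).
have [K KP] : exists K : nat, T + `|t| <= K%:R * P.
  exists (Num.truncn (`|T + `|t| | / P)).+1.
  rewrite -ler_pdivrMr//; apply/ltW.
  apply: le_lt_trans (truncnS_gt _).
  by rewrite ler_pM2r ?invr_gt0// ler_norm.
pose Q := K%:R * P.
have BQ (k : nat) s : B (s + k%:R * Q) = B s.
  rewrite /Q mulrA -natrM; elim: (k * K)%N => [|l IH].
    by rewrite mul0r addr0.
  by rewrite -natr1 mulrDl mul1r addrA BP.
pose xs (k : 'I_n.+1) s := x (s + k%:R * Q).
have [a a0 aM] := left_kernel_nonzero (\matrix_(k, j) xs k 0 j 0).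
pose y s := \sum_k a 0 k *: xs k s.
have yB : has_derivative y (fun s => B s *m y s).
  rewrite (_ : (fun s => _) =
      fun s => \sum_k a 0 k *: (B (s + k%:R * Q) *m x (s + k%:R * Q))).
    apply: has_derivative_comb => k.
    exact: (has_derivative_shift (k%:R * Q) xB).
  apply/funext => s; rewrite mulmx_sumr; apply: eq_bigr => k _.
  by rewrite -scalemxAr BQ.
have y0 : y 0 = 0.
  apply/colP => j; move/rowP/(_ j) : aM; rewrite !mxE; apply: etrans.
  by rewrite summxE; apply: eq_bigr => k _; rewrite !mxE.
have yE := linear_ode_unique cB yB y0.
pose m := [arg max_(k > ord0 | true) `|a 0 k|]%O.
have am k : `|a 0 k| <= `|a 0 m|.
  by rewrite /m; case: arg_maxP => // l _; exact.
have am0 : 0 < `|a 0 m|.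
  rewrite normr_gt0; apply: contraNneq a0 => am0; apply/eqP/rowP => k.
  by apply/eqP; rewrite mxE -normr_le0 (le_trans (am k))// am0 normr0.
(* at this time the translate of index [m] equals [x t] *)
have /colP/(_ i) := yE (t - m%:R * Q).
rewrite summxE (bigD1 m)//= !mxE /xs subrK => /eqP; rewrite addr_eq0 => /eqP E.
have : `|a 0 m| * d <= \sum_(k < n.+1 | k != m) `|a 0 m| * (d / n.+1%:R).
  rewrite -normrM E normrN; apply: le_trans (ler_norm_sum _ _ _) _.
  apply: ler_sum => k km; rewrite mxE normrM; apply: ler_pM => //.
  apply/ltW/xT.
  have Q0 : 0 <= Q by rewrite mulr_ge0// ltW.
  have kmQ : Q <= `|k%:R * Q - m%:R * Q|.
    rewrite -mulrBl normrM (ger0_norm Q0) ler_peMl//.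
    have [lkm|lmk] := ltnP k m.
      rewrite distrC -natrB 1?ltnW// normr_nat ler1n subn_gt0//.
    by rewrite -natrB// normr_nat ler1n subn_gt0 ltn_neqAle lmk andbT eq_sym.
  rewrite (_ : t - m%:R * Q + k%:R * Q = t + (k%:R * Q - m%:R * Q)); last by ring.
  have := ler_normB (t + (k%:R * Q - m%:R * Q)) t.
  rewrite [t + _]addrC addrK; move: KP; rewrite -/Q; lra.
rewrite sumr_const -mulrnAr ler_pM2l// leNgt => /negP; apply.
rewrite -mulrnAr gtr_pMr// -[X in X < _]mulr_natr mulrC.
rewrite ltr_pdivrMr ?ltr0Sn// mul1r ltr_nat ltnS.
by rewrite (@eq_card _ _ (predC1 m))// cardC1 card_ord.
Qed.

End Rigidity.

(** * Reduction to classical solutions, and the theorem *)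

Section ZeroSet.
Variables (R : realType) (n : nat) (J : 'M[R]_n).
Variables (g : R -> 'cV[R]_n -> R -> 'cV[R]_n) (lam : R).
Local Notation mu := (@lebesgue_measure R).
Hypotheses (J_unit : J \in unitmx) (J_inv : invmx J = - J).
Hypothesis g_cont : forall i : 'I_n,
  continuous (fun p : R * 'cV[R]_n => g p.1 p.2 lam i 0).
Hypothesis g0 : forall t, g t 0 lam = 0.
Implicit Types x : R -> 'cV[R]_n.

(** The equation [J wderiv x = g(t, x)] holds almost everywhere and its solved
    form has a continuous right-hand side. *)
Lemma zero_set_classical x : zero_set J g lam x ->
  has_derivative x (fun t => - J *m g t (x t) lam) /\ vanishing_at_infinity x.
Proof.
move=> [xH1 Fx]; have [cx _ _] := xH1.
pose z t := - J *m g t (x t) lam.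
have cz i : continuous (fun t => z t i 0).
  rewrite (_ : (fun t => _) = fun t => \sum_j (- J) i j * g t (x t) lam j 0).
    apply: continuous_bigsum => j.
    apply: continuousMf; first exact: cst_continuous.
    move=> t; apply: (@continuous_comp _ _ _ (fun s => (s, x s))
      (fun p : R * 'cV[R]_n => g p.1 p.2 lam j 0)).
      exact: (cvg_pair (@cvg_id _ (nbhs t)) (cx t)).
    exact: g_cont.
  by apply/funext => t; rewrite mxE.
have wz : {ae mu, forall t, wderiv x t = z t}.
  apply: filterS Fx; first exact: (ae_filter_ringOfSetsType mu).
  move=> t /= /subr0_eq JE.
  by rewrite /z -JE -J_inv mulKmx.
have xz := H1_classical xH1 cz wz.
split; first by move=> i; case: (xz i).
move=> e e0.
have dec (i : 'I_n) : exists T : R, forall t, T <= `|t| -> `|x t i 0| < e.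
  have [dx x2 z2] := xz i.
  exact: (decay_of_derive dx (cz i) x2 z2 e0).
have [T TP] := choice dec.
exists (\big[Num.max/0]_i T i) => t Tt i; apply: TP.
by apply: le_trans Tt; exact: le_bigmax.
Qed.

Lemma zero_set_zero : zero_set J g lam (fun=> 0).
Proof.
split; first exact: in_H1_zero.
apply: filterS (@wderiv_zero R n); first exact: (ae_filter_ringOfSetsType mu).
by move=> t /= wt; rewrite /Fmap wt mulmx0 g0 subrr.
Qed.

Lemma zero_set_eq0 :
  (forall x, has_derivative x (fun t => - J *m g t (x t) lam) ->
     vanishing_at_infinity x -> forall t, x t = 0) ->
  zero_set J g lam = [set (fun=> 0)].
Proof.
move=> rigid; apply/seteqP; split=> [x /zero_set_classical[xz vx]|_ ->].
  by apply/funext => t; exact: rigid.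
exact: zero_set_zero.
Qed.

End ZeroSet.

Unset Implicit Arguments.

Theorem theorem5p3 (R : realType) (N : nat) (J : 'M[R]_(2 * N))
    (H : R -> 'cV[R]_(2 * N) -> R -> R)
    (gp gm : R -> 'cV[R]_(2 * N) -> R -> 'cV[R]_(2 * N)) (lam : R)
    (N_ge1 : (1 <= N)%N)
    (J_unit : J \in unitmx) (J_tr : J^T = invmx J) (J_inv : invmx J = - J)
    (H1 : hypH1 H) (H2 : hypH2 H) (H3 : hypH3 H) (H4 : hypH4 H)
    (Hinf : hypHinf H gp gm) :
  forall g : R -> 'cV[R]_(2 * N) -> R -> 'cV[R]_(2 * N), g = gp \/ g = gm ->
  [/\ (exists C : 'M[R]_(2 * N), C^T = C /\
         forall (t : R) (xi : 'cV[R]_(2 * N)), xi != 0 ->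
           0 < dotv (g t xi lam) (J *m C *m xi)) ->
      zero_set J g lam = [set (fun=> 0)],
      (forall t xi, g t xi lam = A_at0 g lam t *m xi) ->
      zero_set J g lam = [set (fun=> 0)]
    & forall h : 'cV[R]_(2 * N) -> R,
      (forall t s xi, g t xi lam = g s xi lam) ->
      (forall xi : 'cV[R]_(2 * N), differentiable h xi) ->
      (forall t xi, grad h xi = g t xi lam) ->
      isolated_zero h ->
      zero_set J g lam = [set (fun=> 0)]].
Proof.
move=> g gpm.
(* forgetting which end of the line is meant treats [gp] and [gm] at once *)
have [F /(_ lam)[gC1 g0 _ [P P0 gP]]] : exists F, asymptotically_periodic H F g.
  case: Hinf => Hp Hm.
  by case: gpm => ->; [exists (pinfty_nbhs R)|exists (ninfty_nbhs R)].
have g_cont i : continuous (fun p : R * 'cV[R]_(2 * N) => g p.1 p.2 lam i 0).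
  by case: (gC1 i) => -[].
have triv := zero_set_eq0 J_unit J_inv g_cont g0.
have JT : (- J)^T = J by rewrite linearN/= J_tr J_inv opprK.
split.
- move=> [C [CT pos]]; apply: triv => x xz vx.
  apply: (strict_lyapunov_rigid xz vx CT) => t xt0.
  by rewrite dotv_mulmx JT mulmxA; exact: pos.
- move=> lin; apply: triv => x xz vx.
  apply: (@linear_periodic_rigid _ _ x (fun t => - J *m A_at0 g lam t) P) => //.
  + move=> i j; rewrite (_ : (fun t => _) =
      fun t => \sum_k (- J) i k * A_at0 g lam t k j); last first.
      by apply/funext => t; rewrite mxE.
    apply: continuous_bigsum => k; apply: continuousMf.
      exact: cst_continuous.
    have [_ /(_ j)[_ [[dgc _] _]]] := gC1 k.
    rewrite (_ : (fun t => _) = fun t => pderiv j (fun xi => g t xi lam k 0) 0).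
      move=> t; apply: (@continuous_comp _ _ _ (fun s => (s, 0 : 'cV[R]_(2 * N)))
        (fun p : R * 'cV[R]_(2 * N) => pderiv j (fun xi => g p.1 xi lam k 0) p.2)).
        exact: (cvg_pair (@cvg_id _ (nbhs t)) (cvg_cst _)).
      exact: dgc.
    by apply/funext => t; rewrite mxE.
  + by move=> t; rewrite /A_at0; under eq_fun do rewrite gP.
  + by move=> i t; rewrite -mulmxA -lin; exact: xz.
- move=> h _ dh gradh iso; apply: triv => x xz vx.
  apply: (first_integral_rigid xz vx dh) => // t.
  by rewrite (gradh t) dotv_skew// JT opprK.
Qed.
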